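(* Let $A$ be a $d$-dimensional extremal $(0,1)$-matrix of order $n$ and let $\Lambda$ be an optimal hyperplane cover of $A$. Then $A=A(\Lambda)$.
   Context: A $d$-dimensional matrix of order $n$ is an array $(a_\alpha)_{\alpha\in\{1,\dots,n\}^d}$; $\mathrm{supp}(A)=\{\alpha:a_\alpha\ne0\}$; the hyperplane $\Gamma_{i,j}$ is the set of indices with $\alpha_i=j$. A polyplex of weight $W$ is a nonnegative matrix $K$ of order $n$ whose entries sum to at most $1$ over each hyperplane and to $W$ in total; a polydiagonal is a polyplex of weight $n$. A $(0,1)$-matrix $A$ contains $K$ if $\mathrm{supp}(K)\subseteq\mathrm{supp}(A)$. A hyperplane cover of $A$ is a nonnegative $d\times n$ table $\Lambda=(\lambda_{i,j})$ with $\sum_{i=1}^d\lambda_{i,\alpha_i}\ge1$ for all $\alpha\in\mathrm{supp}(A)$; its weight is the sum of its entries; it is optimal if it has minimum weight among hyperplane covers of $A$. For a nonnegative $d\times n$ table $\Lambda$, $A(\Lambda)$ is the $d$-dimensional $(0,1)$-matrix of order $n$ whose support is $\{\alpha:\sum_{i=1}^d\lambda_{i,\alpha_i}\ge 1\}$. A $(0,1)$-matrix $A$ is extremal if it contains no polydiagonal, but for every index $\alpha$ with $a_\alpha=0$ the matrix obtained by changing $a_\alpha$ to $1$ contains a polydiagonal. *)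

(* Defs.v *)
From HB Require Import structures.
From mathcomp Require Import all_boot all_order all_algebra reals.

Set Implicit Arguments.
Unset Strict Implicit.
Unset Printing Implicit Defensive.

Import Order.TTheory GRing.Theory Num.Theory.
Local Open Scope ring_scope.

(* Ordinals are 0-based: 'I_n stands for {1, ..., n}. *)
Notation mdindex d n := {ffun 'I_d -> 'I_n}.
Notation mdmatrix R d n := {ffun mdindex d n -> R}.

Section MultidimensionalMatrices.

Variables (R : realType) (d n : nat).

Definition is_01_matrix (A : mdmatrix R d n) : Prop :=
  forall alpha, A alpha = 0 \/ A alpha = 1.

Definition hyperplane (i : 'I_d) (j : 'I_n) : {set mdindex d n} :=
  [set alpha : mdindex d n | alpha i == j].

Definition polyplex (W : R) (K : mdmatrix R d n) : Prop :=
  [/\ forall alpha, 0 <= K alpha,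
      forall i j, \sum_(alpha in hyperplane i j) K alpha <= 1
    & \sum_alpha K alpha = W].

Definition polydiagonal (K : mdmatrix R d n) : Prop := polyplex n%:R K.

Definition contains (A K : mdmatrix R d n) : Prop :=
  support K \subset support A.

Definition contains_polydiagonal (A : mdmatrix R d n) : Prop :=
  exists K, polydiagonal K /\ contains A K.

Definition set_entry1 (A : mdmatrix R d n) (alpha : mdindex d n) :
    mdmatrix R d n :=
  [ffun beta => if beta == alpha then 1 else A beta].

Definition extremal (A : mdmatrix R d n) : Prop :=
  [/\ is_01_matrix A,
      ~ contains_polydiagonal A
    & forall alpha, A alpha = 0 -> contains_polydiagonal (set_entry1 A alpha)].

Definition nonneg_table (L : 'M[R]_(d, n)) : Prop := forall i j, 0 <= L i j.

Definition hyperplane_cover (A : mdmatrix R d n) (L : 'M[R]_(d, n)) : Prop :=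
  nonneg_table L /\
  forall alpha : mdindex d n, alpha \in support A -> 1 <= \sum_i L i (alpha i).

Definition table_weight (L : 'M[R]_(d, n)) : R := \sum_i \sum_j L i j.

Definition optimal_cover (A : mdmatrix R d n) (L : 'M[R]_(d, n)) : Prop :=
  hyperplane_cover A L /\
  forall L', hyperplane_cover A L' -> table_weight L <= table_weight L'.

Definition matrix_of_table (L : 'M[R]_(d, n)) : mdmatrix R d n :=
  [ffun alpha : mdindex d n => if 1 <= \sum_i L i (alpha i) then 1 else 0].

End MultidimensionalMatrices.

(* Main.v *)
Require Import Defs.
From HB Require Import structures.
From mathcomp Require Import all_boot all_order all_algebra reals.
From mathcomp Require Import ring lra.

(** By Farkas' lemma, a matrix without polydiagonals has a hyperplane cover of
    weight less than [n], so the optimal cover [L] has weight less than [n].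
    If [A alpha = 0] but [L] covers [alpha], then [L] also covers a matrix
    containing a polydiagonal; weak duality then forces its weight to be at
    least [n], a contradiction. *)

Set Implicit Arguments.
Unset Strict Implicit.
Unset Printing Implicit Defensive.

Import Order.TTheory GRing.Theory Num.Theory.
Local Open Scope ring_scope.

Section Farkas.

Variable F : realFieldType.

Lemma seq_lower_bound (s : seq F) : exists v, {in s, forall h, v <= h}.
Proof.
elim: s => [|h s [v vP]]; first by exists 0.
exists (Num.min v h) => g; rewrite inE => /predU1P[->|/vP vg].
  by rewrite ge_min lexx orbT.
by rewrite ge_min vg.
Qed.

(** The one-variable case of elimination: the maximum of [lo] and some lower bound of [hi] works,
    even when a list is empty. *)
Lemma seq_interpolation (lo hi : seq F) :
  {in lo & hi, forall l h, l <= h} ->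
  exists v, {in lo, forall l, l <= v} /\ {in hi, forall h, v <= h}.
Proof.
elim: lo => [_|l lo IH le_lo_hi].
  by have [v vP] := seq_lower_bound hi; exists v.
have [|v [lo_v v_hi]] := IH.
  by move=> g h glo hhi; apply: le_lo_hi => //; rewrite inE glo orbT.
exists (Num.max v l); split=> [g|h hhi].
  by rewrite inE le_max => /predU1P[->|/lo_v->//]; rewrite lexx orbT.
by rewrite ge_max v_hi //= le_lo_hi ?mem_head.
Qed.

(** The pair [(a, b)] stands for the inequality [\sum_t a t * x t <= b]. *)
Definition cone_closed (T : Type) (C : (T -> F) -> F -> Prop) : Prop :=
  forall k l a b a' b', 0 <= k -> 0 <= l -> C a b -> C a' b' ->
    C (fun t => k * a t + l * a' t) (k * b + l * b').

(** Fourier-Motzkin elimination of the variables in [r]. Quantifying over an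
    arbitrary cone [C] replaces explicit multipliers for the derived
    contradictory inequality. *)
Lemma farkas (T : eqType) (r : seq T) (J : finType)
    (a : J -> T -> F) (b : J -> F) (C : (T -> F) -> F -> Prop) :
  uniq r -> cone_closed C -> (forall j, C (a j) (b j)) ->
  (exists x : T -> F, forall j, \sum_(t <- r) a j t * x t <= b j) \/
  (exists a0 b0, [/\ C a0 b0, {in r, forall t, a0 t = 0} & b0 < 0]).
Proof.
elim: r J a b C => [|i r IH] J a b C /=.
  move=> _ _ Cab; case: (boolP [forall j, 0 <= b j]) => [/forallP b_ge0|].
    by left; exists (fun=> 0) => j; rewrite big_nil.
  rewrite negb_forall => /existsP[j]; rewrite -ltNge => bj.
  by right; exists (a j), (b j).
move=> /andP[ir ur] coneC Cab.
(* Weights of the eliminated system: a pair with opposite signs at [i] is combined so that [i]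
   cancels. Any other pair yields row [pq.1] alone if [i] is absent from it, and the trivial
   [0 <= 0] otherwise. *)
pose k (pq : J * J) : F :=
  if (0 < a pq.1 i) && (a pq.2 i < 0) then - a pq.2 i
  else (a pq.1 i == 0)%:R.
pose l (pq : J * J) : F :=
  if (0 < a pq.1 i) && (a pq.2 i < 0) then a pq.1 i else 0.
have k_ge0 pq : 0 <= k pq.
  by rewrite /k; case: ifP => [/andP[_ /ltW]|_]; rewrite ?oppr_ge0 ?ler0n.
have l_ge0 pq : 0 <= l pq by rewrite /l; case: ifP => // /andP[/ltW].
(* Recursing in this subcone makes the final contradictory inequality vanish at [i] too. *)
pose C' a0 b0 := C a0 b0 /\ a0 i = 0.
have coneC' : cone_closed C'.
  move=> u v a1 b1 a2 b2 u0 v0 [C1 a1i] [C2 a2i]; split; first exact: coneC.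
  by rewrite a1i a2i !mulr0 addr0.
have [|[x xP]|[a0 [b0 [[Ca0 a0i] a0r b0_lt0]]]] := IH (J * J)%type
    (fun pq t => k pq * a pq.1 t + l pq * a pq.2 t)
    (fun pq => k pq * b pq.1 + l pq * b pq.2) C' ur coneC'.
- move=> pq; split; first exact: coneC.
  rewrite /k /l; case: ifP => [_|_]; first by ring.
  by case: eqP => [->|_]; rewrite ?mulr0 ?mul0r addr0.
- left; pose S j := \sum_(t <- r) a j t * x t.
  have {}xP p q : k (p, q) * S p + l (p, q) * S q
                  <= k (p, q) * b p + l (p, q) * b q.
    apply: le_trans (xP (p, q)); rewrite /S !mulr_sumr -big_split /=.
    by apply: ler_sum => t _; rewrite mulrDl !mulrA.
  (* The value of variable [i] making row [j] tight: an upper bound if [a j i] is positive, a lower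
     bound if negative. *)
  pose bound j := (b j - S j) / a j i.
  have [|v [lo_v v_hi]] := @seq_interpolation
      [seq bound j | j <- enum J & a j i < 0]
      [seq bound j | j <- enum J & 0 < a j i].
    move=> _ _ /mapP[q + ->] /mapP[p + ->].
    rewrite !mem_filter => /andP[qi _] /andP[pi _].
    have := xP p q; rewrite /k /l /= pi qi /= => pq.
    rewrite /bound ler_ndivrMr // mulrAC ler_pdivrMr //.
    by nra.
  exists (fun t => if t == i then v else x t) => j.
  rewrite big_cons eqxx (eq_big_seq (fun t => a j t * x t)); last first.
    by move=> t tr; case: eqP tr ir => // -> ->.
  rewrite -/(S j) -lerBrDr.
  case: (ltgtP (a j i) 0) => [ji|ji|ji].
  + have : bound j <= v by apply/lo_v/map_f; rewrite mem_filter ji mem_enum.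
    by rewrite /bound ler_ndivrMr // mulrC.
  + have : v <= bound j by apply/v_hi/map_f; rewrite mem_filter ji mem_enum.
    by rewrite /bound ler_pdivlMr // mulrC.
  (* The diagonal pair returns row [j] itself. *)
  + have := xP j j; rewrite /k /l /= ji ltxx eqxx /= !mul1r !mul0r !addr0.
    by rewrite subr_ge0.
- right; exists a0, b0; split=> // t; rewrite inE => /predU1P[->//|]; exact: a0r.
Qed.

End Farkas.

Section Covers.

Variables (R : realType) (d n : nat).
Implicit Types (A K : mdmatrix R d n) (L : 'M[R]_(d, n)).

(** Weak duality, by double counting [\sum_alpha K alpha * \sum_i L i (alpha i)]: the inner sum is
    at least 1 on the support of [K], while each [L i j] is multiplied by a hyperplane sum of [K],
    at most 1. *)
Lemma polyplex_weight_le_cover A K L (W : R) :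
  polyplex W K -> contains A K -> hyperplane_cover A L -> W <= table_weight L.
Proof.
move=> [K_ge0 K_le1 <-] /subsetP AK [L_ge0 L_cov].
apply: (@le_trans _ _ (\sum_alpha K alpha * \sum_i L i (alpha i))).
  apply: ler_sum => alpha _; have [->|Kn0] := eqVneq (K alpha) 0.
    by rewrite mul0r.
  by rewrite ler_peMr //; apply/L_cov/AK.
under eq_bigr => alpha _ do rewrite mulr_sumr.
rewrite exchange_big; apply: ler_sum => i _ /=.
rewrite (partition_big (fun alpha : mdindex d n => alpha i) predT) //=.
apply: ler_sum => j _.
rewrite (eq_bigr (fun alpha => K alpha * L i j)); last first.
  by move=> alpha /eqP ->.
rewrite -mulr_suml ler_piMl // (le_trans _ (K_le1 i j)) //.
by rewrite le_eqVlt (eq_bigl _ _ (fun alpha => in_set _ _)) eqxx.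
Qed.

(** Farkas is applied to the system defining polydiagonals supported in [A]. In a certificate of
    infeasibility, the multipliers of the hyperplane inequalities form a cover up to scaling; those
    of [0 <= K alpha] are absorbed as slack in [C]. *)
Lemma cover_weight_lt A :
  ~ contains_polydiagonal A ->
  exists L, hyperplane_cover A L /\ table_weight L < n%:R.
Proof.
move=> noK.
(* [t] may be negative: it is the multiplier of the equation
   [n - \sum_alpha K alpha = 0]. *)
pose C (a : mdindex d n -> R) (b : R) := exists L (t : R),
  [/\ nonneg_table L,
      forall alpha, a alpha <= \sum_i L i (alpha i) - t
    & table_weight L - t * n%:R <= b].
have coneC : cone_closed C.
  move=> k l a b a' b' k0 l0 [L [t [L0 La Lb]]] [L' [t' [L'0 La' Lb']]].
  exists (k *: L + l *: L'), (k * t + l * t'); split.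
  - by move=> i j; rewrite !mxE addr_ge0 ?mulr_ge0.
  - move=> alpha; under eq_bigr => i _ do rewrite !mxE.
    rewrite big_split /= -!mulr_sumr.
    have := ler_wpM2l k0 (La alpha); have := ler_wpM2l l0 (La' alpha).
    by rewrite !mulrBr; lra.
  - have -> : table_weight (k *: L + l *: L')
              = k * table_weight L + l * table_weight L'.
      rewrite /table_weight !mulr_sumr -big_split; apply: eq_bigr => i _ /=.
      rewrite !mulr_sumr -big_split; apply: eq_bigr => j _ /=.
      by rewrite !mxE.
    have := ler_wpM2l k0 Lb; have := ler_wpM2l l0 Lb'.
    by rewrite !mulrBr; lra.
(* The rows: hyperplane sums, nonnegativity, and the total weight as two opposite inequalities. *)
pose J := ('I_d * 'I_n + (mdindex d n + bool))%type.
pose a (u : J) (alpha : mdindex d n) : R :=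
  match u with
  | inl (i, j) => (alpha i == j)%:R
  | inr (inl beta) => - (alpha == beta)%:R
  | inr (inr s) => (-1) ^+ s
  end.
pose b (u : J) : R :=
  match u with
  | inl _ => 1
  | inr (inl _) => 0
  | inr (inr s) => (-1) ^+ s * n%:R
  end.
have weight0 : table_weight (0 : 'M[R]_(d, n)) = 0.
  by rewrite /table_weight big1 // => i _; rewrite big1 // => j _; rewrite mxE.
have Cab u : C (a u) (b u).
  case: u => [[i j]|[beta|s]].
  - exists (delta_mx i j), 0; split.
    + by move=> i' j'; rewrite mxE ler0n.
    + move=> alpha; rewrite subr0 (bigD1 i) //= mxE eqxx /= lerDl.
      by apply: sumr_ge0 => i' _; rewrite mxE ler0n.
    + rewrite mul0r subr0 /table_weight (bigD1 i) //= (bigD1 j) //= mxE !eqxx.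
      rewrite big1 => [|j' /negPf nj]; last by rewrite mxE nj andbF.
      rewrite big1 ?addr0 // => i' /negPf ni.
      by rewrite big1 // => j' _; rewrite mxE ni.
  - exists 0, 0; split; last by rewrite weight0 mul0r subr0.
      by move=> i j; rewrite mxE.
    move=> alpha; rewrite big1 => [|i _]; last by rewrite mxE.
    by rewrite subr0 /= oppr_le0 ler0n.
  - exists 0, (- (-1) ^+ s); split.
    + by move=> i j; rewrite mxE.
    + move=> alpha; rewrite big1 => [|i _]; last by rewrite mxE.
      by rewrite opprK add0r.
    + by rewrite weight0 mulNr opprK add0r.
(* Only entries in [support A] are variables; a solution is extended by 0. *)
have [[x xP]|] := farkas (enum_uniq (support A)) coneC Cab.
  case: noK; pose K : mdmatrix R d n :=
    [ffun alpha => if alpha \in support A then x alpha else 0].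
  have {}xP u : \sum_alpha a u alpha * K alpha <= b u.
    rewrite (le_trans _ (xP u)) // big_enum /= [leRHS]big_mkcond /=.
    by apply: ler_sum => alpha _; rewrite ffunE; case: ifP; rewrite ?mulr0.
  exists K; split; last first.
    apply/subsetP => alpha; rewrite [in X in X -> _]inE /= ffunE.
    by case: ifP => //; rewrite eqxx.
  split.
  - move=> beta; have := xP (inr (inl beta)) => /=.
    rewrite (bigD1 beta) //= eqxx big1 => [|alpha /negPf ->].
      by rewrite addr0 mulN1r oppr_le0.
    by rewrite oppr0 mul0r.
  - move=> i j; rewrite (le_trans _ (xP (inl (i, j)))) //= big_mkcond /=.
    by apply: ler_sum => alpha _; rewrite inE; case: eqP; rewrite ?mul1r ?mul0r.
  - apply/eqP; rewrite eq_le.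
    have := xP (inr (inr true)); have := xP (inr (inr false)) => /=.
    by rewrite -!mulr_sumr !expr0 !expr1 !mul1r !mulN1r lerN2 => -> ->.
case=> a0 [b0 [[L [t [L0 La Lb]]] a0r b0_lt0]].
have wL0 : 0 <= table_weight L.
  by apply: sumr_ge0 => i _; apply: sumr_ge0 => j _; apply: L0.
have wLt : table_weight L < t * n%:R by rewrite -subr_lt0 (le_lt_trans Lb).
have t0 : 0 < t.
  rewrite ltNge; apply/negP => t0.
  by have := le_lt_trans wL0 wLt; rewrite ltNge mulr_le0_ge0.
(* On [support A], [a0] vanishes, so [L] sums to at least [t] there; dividing by [t] gives a
   cover. *)
exists (t^-1 *: L); split; first split.
- by move=> i j; rewrite mxE mulr_ge0 ?L0 // invr_ge0 ltW.
- move=> alpha alphaA; under eq_bigr => i _ do rewrite mxE.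
  rewrite -mulr_sumr mulrC ler_pdivlMr // mul1r -subr_ge0.
  by rewrite (le_trans _ (La alpha)) // a0r ?mem_enum.
- have -> : table_weight (t^-1 *: L) = t^-1 * table_weight L.
    rewrite /table_weight mulr_sumr; apply: eq_bigr => i _.
    by rewrite mulr_sumr; apply: eq_bigr => j _; rewrite mxE.
  by rewrite mulrC ltr_pdivrMr // mulrC.
Qed.

End Covers.

Theorem theorem4p1 (R : realType) (d n : nat) (A : mdmatrix R d n)
    (L : 'M[R]_(d, n)) (hA : extremal A) (hL : optimal_cover A L) :
  A = matrix_of_table L.
Proof.
case: hA hL => A01 noK A1K [[L0 Lcov] Lmin].
have [L' [L'cov L'lt]] := cover_weight_lt noK.
have L_lt := le_lt_trans (Lmin _ L'cov) L'lt.
apply/ffunP => alpha; rewrite ffunE; case: ifPn => [Lalpha|]; last first.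
  case: (eqVneq (A alpha) 0) => // Aalpha /negP[]; exact: Lcov.
case: (A01 alpha) => // /A1K [K [diagK AK]].
(* The only index that can be new in the support is [alpha], covered by [Lalpha]. *)
have covL : hyperplane_cover (set_entry1 A alpha) L.
  split=> // beta; rewrite inE /= ffunE.
  by case: (beta =P alpha) => [->|_ Abeta]; [by []|exact: Lcov].
by have := polyplex_weight_le_cover diagK AK covL; rewrite leNgt L_lt.
Qed.
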